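(* Let $m,n\ge 1$, let $G\subseteq \mathrm{GL}_m(\mathbb{C})\times\mathrm{GL}_n(\mathbb{C})$ be a symmetric subgroup with $K=G\cap(\mathrm{U}_m\times\mathrm{U}_n)$, let $\|\cdot\|_1$ be a unitarily invariant matrix norm on $\mathbb{C}^{m\times n}$ and $\|\cdot\|_2$ a unitarily invariant matrix norm on $\mathbb{C}^{n\times m}$. (i) For every nonzero $A\in\mathbb{C}^{m\times n}$, the function $C_A:G/K\to\mathbb{R}$, $$C_A(K(X,Y))=\log\|XAY^{-1}\|_1+\log\|YA^{\dagger}X^{-1}\|_2,$$ is geodesically convex. (ii) For every polynomial system $\mathbf f=(f_1,\dots,f_m)$, $f_i\in\mathbb{C}[x_1,\dots,x_n]$, with $\mathbf f\neq 0$, and every $\xi\in\mathbb{C}^n$ with $D_\xi(\mathbf f)\neq 0$, the function $C_{(\mathbf f,\xi)}:G/K\to\mathbb{R}$, $$C_{(\mathbf f,\xi)}(K(X,Y))=\log\|(X,Y)\cdot\mathbf f\|_W+\log\|Y\,D_\xi(\mathbf f)^{\dagger}X^{-1}\|_2,$$ is geodesically convex.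
   Context: A subgroup $G\subseteq\mathrm{GL}_m(\mathbb{C})\times\mathrm{GL}_n(\mathbb{C})$ is symmetric if it is Zariski closed and $(X,Y)\in G\Rightarrow (X^*,Y^* )\in G$ ($^*$ = conjugate transpose). $K=G\cap(\mathrm{U}_m\times\mathrm{U}_n)$; $\mathrm{Lie}(G)=\{(H_1,H_2): (e^{tH_1},e^{tH_2})\in G\ \forall t\in\mathbb{R}\}$, and $i\mathrm{Lie}(K)$ is the set of pairs of Hermitian matrices in $\mathrm{Lie}(G)$. $G/K=\{Kg: g\in G\}$ is the set of right cosets. A function $f:G/K\to\mathbb{R}$ is geodesically convex if $t\mapsto f(Ke^{tH}g)$ is convex on $\mathbb{R}$ for every $g\in G$ and $H=(H_1,H_2)\in i\mathrm{Lie}(K)$, where $e^{tH}g=(e^{tH_1}X,e^{tH_2}Y)$ for $g=(X,Y)$. $M^\dagger$ denotes the Moore–Penrose pseudoinverse. (The function in (i) equals $\log\kappa(XAY^{-1})$ with $\kappa(B)=\|B\|_1\|B^\dagger\|_2$ whenever $(XAY^{-1})^\dagger=YA^\dagger X^{-1}$, e.g. when $A$ is invertible.) Polynomial actions: $X\in\mathrm{GL}_m(\mathbb{C})$ acts by $(X\cdot\mathbf f)_i=\sum_{j=1}^m X_{ij}f_j$; $Y\in\mathrm{GL}_n(\mathbb{C})$ acts by $Y\cdot\mathbf f=(f_1\circ Y^{-1},\dots,f_m\circ Y^{-1})$; $(X,Y)\cdot\mathbf f=X\cdot(Y\cdot\mathbf f)$. $D_\xi(\mathbf f)\in\mathbb{C}^{m\times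 n}$ is the Jacobian of $\mathbf f$ at $\xi$. Bombieri–Weyl norm: on homogeneous polynomials of degree $e$ in $n$ variables, the inner product with $\langle x^\alpha,x^\beta\rangle=0$ for $\alpha\neq\beta$ and $\langle x^\alpha,x^\alpha\rangle=\alpha_1!\cdots\alpha_n!/e!$ (linear in the first argument, conjugate-linear in the second); for polynomials of bounded degree, $\langle f,g\rangle=\sum_k\langle f^{(k)},g^{(k)}\rangle$ where $f^{(k)}$ is the degree-$k$ homogeneous part; for systems, $\langle\mathbf f,\mathbf g\rangle=\sum_i\langle f_i,g_i\rangle$ and $\|\mathbf f\|_W=\sqrt{\langle\mathbf f,\mathbf f\rangle}$. *)

(* Defs.v *)
From HB Require Import structures.
From mathcomp Require Import all_boot all_order all_algebra.
From mathcomp Require Import complex.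
From mathcomp Require Import mpoly.
From mathcomp Require Import all_classical all_reals all_analysis.

Set Implicit Arguments.
Unset Strict Implicit.
Unset Printing Implicit Defensive.
Import Order.TTheory GRing.Theory Num.Theory.
Import numFieldNormedType.Exports.
Local Open Scope ring_scope.
Local Open Scope classical_set_scope.

Section Defs.
Variable R : realType.
Local Notation C := (R[i]).

Definition cmod (z : C) : R := ComplexField.Normc.normc z.

Definition mxstar (p q : nat) (A : 'M[C]_(p, q)) : 'M[C]_(q, p) :=
  (map_mx Num.conj A)^T.

Definition unitary (p : nat) (U : 'M[C]_p) : Prop := U *m mxstar U = 1%:M.
Definition hermitian (p : nat) (H : 'M[C]_p) : Prop := mxstar H = H.

Definition unitarily_invariant_norm (p q : nat) (N : 'M[C]_(p, q) -> R) : Prop :=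
  [/\ forall A, N A = 0 -> A = 0,
      forall (c : C) A, N (c *: A) = cmod c * N A,
      forall A B, N (A + B) <= N A + N B &
      forall (U : 'M[C]_p) (V : 'M[C]_q) A,
        unitary U -> unitary V -> N (U *m A *m V) = N A].

Definition penrose (p q : nat) (A : 'M[C]_(p, q)) (B : 'M[C]_(q, p)) : Prop :=
  [/\ A *m B *m A = A, B *m A *m B = B,
      mxstar (A *m B) = A *m B & mxstar (B *m A) = B *m A].
Definition pinv (p q : nat) (A : 'M[C]_(p, q)) : 'M[C]_(q, p) :=
  xget 0 [set B | penrose A B].

Definition expm (p : nat) (A : 'M[C]_p) : 'M[C]_p :=
  limn (series (fun k : nat => (k`!%:R)^-1 *: A ^+ k)).

Variables m n : nat.
Local Notation pair := ('M[C]_m * 'M[C]_n)%type.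

Definition is_subgroup_GL (G : set pair) : Prop :=
  [/\ forall g, G g -> g.1 \in unitmx /\ g.2 \in unitmx,
      G (1%:M, 1%:M),
      forall g h, G g -> G h -> G (g.1 *m h.1, g.2 *m h.2) &
      forall g, G g -> G (invmx g.1, invmx g.2)].

Definition entries (X : 'M[C]_m) (Y : 'M[C]_n) : 'I_(m * m + n * n) -> C :=
  fun k => row_mx (mxvec X) (mxvec Y) 0 k.

Definition zariski_closed_GL (G : set pair) : Prop :=
  exists P : set (mpoly.mpoly (m * m + n * n) C),
    forall X Y, X \in unitmx -> Y \in unitmx ->
      (G (X, Y) <-> forall p, P p -> mpoly.meval (entries X Y) p = 0).

Definition symmetric_subgroup (G : set pair) : Prop :=
  [/\ is_subgroup_GL G, zariski_closed_GL G &
      forall g, G g -> G (mxstar g.1, mxstar g.2)].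

Definition Kof (G : set pair) : set pair :=
  [set g | G g /\ unitary g.1 /\ unitary g.2].

Definition Lie (G : set pair) : set pair :=
  [set H | forall t : R,
     G (expm (real_complex R t *: H.1), expm (real_complex R t *: H.2))].

Definition iLieK (G : set pair) : set pair :=
  [set H | Lie G H /\ hermitian H.1 /\ hermitian H.2].

Definition convex_R (phi : R -> R) : Prop :=
  forall a b s, 0 <= s <= 1 ->
    phi ((1 - s) * a + s * b) <= (1 - s) * phi a + s * phi b.

(* A function on G/K is represented by its lift F to G (F (X, Y) is the value
   at the right coset K(X,Y)).  geodesically_convex G F says that F indeed
   defines a function on G/K (it is constant on right K-cosets of G) and that
   this function is geodesically convex. *)
Definition geodesically_convex (G : set pair) (F : pair -> R) : Prop :=
  (forall k g, Kof G k -> G g -> F (k.1 *m g.1, k.2 *m g.2) = F g) /\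
  (forall g H, G g -> iLieK G H ->
     convex_R (fun t => F (expm (real_complex R t *: H.1) *m g.1,
                           expm (real_complex R t *: H.2) *m g.2))).

Definition C_mat (N1 : 'M[C]_(m, n) -> R) (N2 : 'M[C]_(n, m) -> R)
    (A : 'M[C]_(m, n)) (g : pair) : R :=
  ln (N1 (g.1 *m A *m invmx g.2)) + ln (N2 (g.2 *m pinv A *m invmx g.1)).

Local Notation poly := (mpoly.mpoly n C).

Definition actX (X : 'M[C]_m) (f : 'I_m -> poly) : 'I_m -> poly :=
  fun i => \sum_(j < m) X i j *: f j.

Definition linsubst (B : 'M[C]_n) : n.-tuple poly :=
  [tuple \sum_(k < n) B j k *: @mpoly.mpolyX n C (mpoly.mnm1 k) | j < n].

Definition actY (Y : 'M[C]_n) (f : 'I_m -> poly) : 'I_m -> poly :=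
  fun i => mpoly.comp_mpoly (linsubst (invmx Y)) (f i).

Definition sys_act (g : pair) (f : 'I_m -> poly) : 'I_m -> poly :=
  actX g.1 (actY g.2 f).

Definition poly_jacobian (f : 'I_m -> poly) (xi : 'cV[C]_n) : 'M[C]_(m, n) :=
  \matrix_(i < m, j < n) mpoly.meval (fun k => xi k 0) (mpoly.mderiv j (f i)).

(* Bombieri--Weyl inner product: <x^a, x^b> = 0 for a <> b and
   <x^a, x^a> = a_1! ... a_n! / |a|! *)
Definition bw_inner_poly (p q : poly) : C :=
  \sum_(a <- undup (mpoly.msupp p ++ mpoly.msupp q))
     mpoly.mcoeff a p * Num.conj (mpoly.mcoeff a q) *
     ((\prod_(j < n) (a j)`!)%:R / (mpoly.mdeg a)`!%:R).

Definition bw_inner (f g : 'I_m -> poly) : C :=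
  \sum_(i < m) bw_inner_poly (f i) (g i).

Definition bw_norm (f : 'I_m -> poly) : R := Num.sqrt (complex.Re (bw_inner f f)).

Definition C_sys (N2 : 'M[C]_(n, m) -> R) (f : 'I_m -> poly) (xi : 'cV[C]_n)
    (g : pair) : R :=
  ln (bw_norm (sys_act g f)) + ln (N2 (g.2 *m pinv (poly_jacobian f xi) *m invmx g.1)).

End Defs.

(* Main.v *)
(** Along a geodesic, the spectral theorem and the invariance of the norms turn
    [e^{tH} g] into the action of diagonal matrices with entries [e^{t d_j}] and
    [e^{t e_k}].

    For a unitarily invariant norm [N] this leaves the path [M t] with entries
    [e^{t (d_j - e_k)} B_jk], and [N (M t)] must be shown log-convex.  Replacing [d] by
    [d + l] multiplies [N (M t)] by [e^{l t}], so it is enough to show convexity for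
    all [d] and [e].  Put [ad W := D W - W E].  The maps [e^{iy ad}] are isometries, so
    [i ad] is dissipative: [N W <= N (W + i ad W)], hence [N W <= N (W + a ad^2 W)]
    for [a >= 0].  As [M (t + h) + M (t - h) = 2 M t + h^2 ad^2 (M t) + O(h^3)], the
    second differences of [N (M t)] are at least [- O(h^3)], which gives convexity.

    The Bombieri-Weyl norm is unitarily invariant because [p |-> p o B] and
    [q |-> q o B^*] are adjoint, by induction on [p] from the adjointness of
    multiplication by [x_j] and [d/dx_j] for the Fischer product.  Under diagonal
    matrices its square is a sum of exponentials with nonnegative coefficients, which is
    log-convex. *)
Require Import Defs.
From HB Require Import structures.
From mathcomp Require Import all_boot all_order all_algebra.
From mathcomp Require Import complex.
From mathcomp Require Import mpoly.
From mathcomp Require Import all_classical all_reals all_analysis.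
From mathcomp Require Import ring lra.
Set Implicit Arguments.
Unset Strict Implicit.
Unset Printing Implicit Defensive.
Import Order.TTheory GRing.Theory Num.Theory.
Import numFieldNormedType.Exports.
Local Open Scope ring_scope.
Local Open Scope classical_set_scope.

(** * Convexity criteria on the real line *)

Lemma eq_convex_R (R : realType) (f g : R -> R) : f =1 g -> convex_R f -> convex_R g.
Proof. by move=> /funext ->. Qed.

(* Adding [e (t - a) (t - b)] to [phi] minus its chord makes a positive interior maximum
   contradict the bound on second differences. *)
Lemma convex_R_of_second_difference (R : realType) (phi K : R -> R) (r : R) :
  continuous phi -> 0 < r ->
  (forall c h, 0 < h <= r ->
     - K c * h ^+ 3 <= phi (c + h) + phi (c - h) - 2 * phi c) ->
  convex_R phi.
Proof.
move=> cphi r0 dd.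
suff H a b s : a < b -> 0 <= s <= 1 ->
    phi ((1 - s) * a + s * b) <= (1 - s) * phi a + s * phi b.
  move=> a b s s01; case: (ltgtP a b) => [ab|ba|->]; first exact: H.
  - rewrite addrC [leRHS]addrC -{1 3}(subKr 1 s); apply: H => //; lra.
  - by rewrite -!mulrDl subrK !mul1r.
move=> ab /andP[s0 s1]; rewrite leNgt; apply/negP => lt.
set t0 := (1 - s) * a + s * b in lt.
pose L t := phi a + (phi b - phi a) / (b - a) * (t - a).
have ba0 : 0 < b - a by rewrite subr_gt0.
have Lt0 : L t0 = (1 - s) * phi a + s * phi b.
  by rewrite /L /t0; field; rewrite lt0r_neq0.
pose d := phi t0 - L t0.
have d0 : 0 < d by rewrite /d Lt0 subr_gt0.
(* With this [e] the quadratic term costs at most [d / 8] at [t0], so [psi t0] stays positive. *)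
pose e := d / (2 * (b - a) ^+ 2).
have e0 : 0 < e by rewrite divr_gt0 // mulr_gt0 // exprn_gt0.
pose psi t := phi t - L t + e * ((t - a) * (t - b)).
have psia : psi a = 0 by rewrite /psi /L subrr; ring.
have psib : psi b = 0 by rewrite /psi /L; field; rewrite lt0r_neq0.
have t0ab : t0 \in `[a, b]%R.
  by rewrite in_itv /= /t0; apply/andP; split; nra.
have psit0 : 0 < psi t0.
  have -> : psi t0 = d * (1 - s * (1 - s) / 2).
    by rewrite /psi -/d /e /t0; field; rewrite lt0r_neq0.
  apply: mulr_gt0 => //; nra.
have cL : continuous L.
  move=> x; apply: cvgD; first exact: cvg_cst.
  by apply: cvgM; [exact: cvg_cst | apply: cvgB; [exact: cvg_id | exact: cvg_cst]].
have cpsi : continuous psi.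
  move=> x; apply: cvgD; first by apply: cvgB; [exact: cphi | exact: cL].
  apply: cvgM; first exact: cvg_cst.
  by apply: cvgM; apply: cvgB; (exact: cvg_id || exact: cvg_cst).
have [c cab cmax] := EVT_max (ltW ab) (continuous_subspaceT cpsi).
have psic : 0 < psi c by apply: lt_le_trans psit0 (cmax _ t0ab).
have ca : a < c.
  rewrite lt_neqAle (itvP cab) andbT; apply/eqP => E.
  by move: psic; rewrite -E psia ltxx.
have cb : c < b.
  rewrite lt_neqAle (itvP cab) andbT; apply/eqP => E.
  by move: psic; rewrite E psib ltxx.
(* This [h] keeps [c - h] and [c + h] inside [[a, b]], respects [r], and makes the error [K c * h^3]
   smaller than the gain [2 e h^2]. *)
pose h := Num.min (Num.min (c - a) (b - c)) (Num.min r (e / (`|K c| + 1))).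
have K0 : 0 < `|K c| + 1 by rewrite ltr_wpDl.
have h0 : 0 < h by rewrite !lt_min !subr_gt0 ca cb r0 divr_gt0.
have [hca hbc h1 hK] : [/\ h <= c - a, h <= b - c, h <= r & h * (`|K c| + 1) <= e].
  by rewrite -ler_pdivlMr //; split; rewrite /h !ge_min lexx ?orbT.
have hp : psi (c + h) <= psi c by apply: cmax; rewrite in_itv /=; lra.
have hm : psi (c - h) <= psi c by apply: cmax; rewrite in_itv /=; lra.
have := dd c h; rewrite h0 h1 => /(_ isT).
have E2 : psi (c + h) + psi (c - h) - 2 * psi c =
     phi (c + h) + phi (c - h) - 2 * phi c + 2 * e * h ^+ 2.
  by rewrite /psi /L; ring.
have : 0 < 2 * e * h ^+ 2 - K c * h ^+ 3.
  have -> : 2 * e * h ^+ 2 - K c * h ^+ 3 = h ^+ 2 * (2 * e - K c * h) by ring.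
  rewrite mulr_gt0 ?exprn_gt0 //.
  have := ler_wpM2r (ltW h0) (ler_norm (K c)).
  lra.
lra.
Qed.

(** With [y := x / 2] and [q := e^y - e^-y], the quantity is [q^2 - 4 y^2]; the inequality
    [1 + y <= e^y], used at [y] and [-y], confines [q] to within [O(y^2)] of [2 y]. *)
Lemma cosh_second_order (R : realType) (x : R) : `|x| <= 1 ->
  `|expR x + expR (- x) - 2 - x ^+ 2| <= 4 * `|x| ^+ 3.
Proof.
wlog x0 : x / 0 <= x => [H x1|].
  case: (leP 0 x) => [x0|/ltW x0]; first exact: H.
  have := H (- x); rewrite opprK normrN sqrrN (addrC (expR _)); apply=> //.
  by rewrite oppr_ge0.
rewrite (ger0_norm x0) => x1; pose y := x / 2.
have y0 : 0 <= y by rewrite /y; lra.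
have y1 : y <= 1 / 2 by rewrite /y; lra.
have xy : x = y + y by rewrite /y; lra.
pose E := expR y; pose F := expR (- y); pose q := E - F.
have EF : E * F = 1 by rewrite /E /F -expRD subrr expR0.
have E1 : 1 + y <= E := expR_ge1Dx y.
have F1 : 1 - y <= F := expR_ge1Dx (- y).
have Eu : E * (1 - y) <= 1.
  by rewrite -[leRHS]EF ler_wpM2l // expR_ge0.
have Fu : F * (1 + y) <= 1.
  by rewrite -[leRHS]EF mulrC ler_wpM2r // expR_ge0.
have -> : expR x + expR (- x) - 2 - x ^+ 2 = q ^+ 2 - 4 * y ^+ 2.
  have -> : expR x = E * E by rewrite xy expRD.
  have -> : expR (- x) = F * F by rewrite xy opprD expRD.
  by rewrite xy /q sqrrB EF; ring.
have qu : q <= 2 * y + 2 * y ^+ 2.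
  have : q * (1 - y) <= 2 * y - y ^+ 2.
    by rewrite /q mulrBl; nra.
  nra.
have ql : 2 * y - y ^+ 2 <= q.
  have : 2 * y + y ^+ 2 <= q * (1 + y).
    by rewrite /q mulrBl; nra.
  nra.
have q0 : 0 <= 2 * y - y ^+ 2 by nra.
have qu2 : q ^+ 2 <= (2 * y + 2 * y ^+ 2) ^+ 2 by rewrite lerXn2r // nnegrE; nra.
have ql2 : (2 * y - y ^+ 2) ^+ 2 <= q ^+ 2 by rewrite lerXn2r // nnegrE; nra.
have y3 : 0 <= y ^+ 3 by rewrite exprn_ge0.
have y4 : y ^+ 4 <= y ^+ 3 / 2 by rewrite exprSr; nra.
have y40 : 0 <= y ^+ 4 by rewrite exprn_ge0.
have -> : x ^+ 3 = 8 * y ^+ 3 by rewrite xy; ring.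
rewrite ler_norml; apply/andP; split.
  apply: le_trans (lerB ql2 (lexx _)).
  have -> : (2 * y - y ^+ 2) ^+ 2 = 4 * y ^+ 2 - 4 * y ^+ 3 + y ^+ 4 by ring.
  lra.
apply: le_trans (lerB qu2 (lexx _)) _.
have -> : (2 * y + 2 * y ^+ 2) ^+ 2 = 4 * y ^+ 2 + 8 * y ^+ 3 + 4 * y ^+ 4 by ring.
lra.
Qed.

(* The slope [l] making [expR (l * t) * phi t] equal at both ends turns convexity
   into the chord bound for [ln phi]. *)
Lemma convex_R_ln (R : realType) (phi : R -> R) :
  (forall t, 0 < phi t) ->
  (forall l, convex_R (fun t => expR (l * t) * phi t)) ->
  convex_R (fun t => ln (phi t)).
Proof.
move=> phi0 cvx a b s s01.
have [->|ab] := eqVneq a b; first by rewrite -!mulrDl subrK !mul1r.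
pose l := (ln (phi a) - ln (phi b)) / (b - a).
pose k := l * a + ln (phi a).
have phiE t : expR (l * t) * phi t = expR (l * t + ln (phi t)).
  by rewrite expRD lnK // posrE.
have Ek : l * b + ln (phi b) = k.
  by rewrite /k /l; field; rewrite subr_eq0 eq_sym.
have := cvx l a b s s01; rewrite !phiE Ek -/k -mulrDl subrK mul1r ler_expR => H.
have -> : (1 - s) * ln (phi a) + s * ln (phi b) =
    k - l * ((1 - s) * a + s * b).
  have -> : ln (phi b) = k - l * b by rewrite -Ek addrC addKr.
  have -> : ln (phi a) = k - l * a by rewrite /k addrC addKr.
  by ring.
by rewrite lerBrDl.
Qed.

(** * Unitarily invariant norms *)

Lemma cmod_ge0 (R : realType) (z : R[i]) : 0 <= cmod z.
Proof. by case: z => a b; apply: sqrtr_ge0. Qed.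

Lemma cmodM (R : realType) (y z : R[i]) : cmod (y * z) = cmod y * cmod z.
Proof. exact: ComplexField.Normc.normcM. Qed.

Lemma cmod_real (R : realType) (x : R) : cmod (real_complex R x) = `|x|.
Proof. by rewrite /cmod /= expr0n addr0 sqrtr_sqr. Qed.

Lemma mxstar_diag (R : realType) (p : nat) (u : 'rV[R[i]]_p) :
  mxstar (diag_mx u) = diag_mx (\row_j (u 0 j)^*).
Proof.
rewrite /mxstar map_diag_mx tr_diag_mx; congr diag_mx.
by apply/rowP => j; rewrite !mxE.
Qed.

Lemma unitary_diag (R : realType) (p : nat) (u : 'rV[R[i]]_p) :
  (forall j, u 0 j * (u 0 j)^* = 1) -> unitary (diag_mx u).
Proof.
move=> u1; rewrite /unitary mxstar_diag mulmx_diag -diag_const_mx; congr diag_mx.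
by apply/rowP => j; rewrite !mxE u1.
Qed.

Section UnitarilyInvariantNorm.
Variables (R : realType) (p q : nat) (N : 'M[R[i]]_(p, q) -> R).
Hypothesis uN : unitarily_invariant_norm N.
Local Notation rc := (real_complex R).
Local Notation I := (Complex (0 : R) 1).

Lemma uin_real (x : R) A : N (rc x *: A) = `|x| * N A.
Proof. by case: uN => _ -> _ _; rewrite cmod_real. Qed.

Lemma uin0 : N 0 = 0.
Proof. by rewrite -(scale0r (0 : 'M[R[i]]_(p, q))) -[0]/(rc 0) uin_real normr0 mul0r. Qed.

Lemma uinN A : N (- A) = N A.
Proof. by rewrite -scaleN1r -(rmorphN1 rc) uin_real normrN1 mul1r. Qed.

Lemma uin_leD A B : N (A + B) <= N A + N B.
Proof. by case: uN. Qed.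

Lemma uin_ge0 A : 0 <= N A.
Proof. by have := uin_leD A (- A); rewrite subrr uin0 uinN; lra. Qed.

Lemma uin_gt0 A : A != 0 -> 0 < N A.
Proof.
move=> A0; rewrite lt_neqAle uin_ge0 andbT eq_sym; apply: contra_neq A0.
by case: uN => + _ _ _; apply.
Qed.

(** The phases amount to multiplication by diagonal unitary matrices on both sides. *)
Lemma uin_diag (u : 'I_p -> R[i]) (v : 'I_q -> R[i]) (A : 'M[R[i]]_(p, q)) :
  (forall j, u j * (u j)^* = 1) -> (forall k, v k * (v k)^* = 1) ->
  N (\matrix_(j, k) (u j * A j k * v k)) = N A.
Proof.
move=> u1 v1; case: uN => _ _ _ inv.
rewrite -(inv (diag_mx (\row_j u j)) (diag_mx (\row_k v k)) A).
- by rewrite mul_diag_mx mul_mx_diag; congr N; apply/matrixP => j k; rewrite !mxE.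
- by apply: unitary_diag => j; rewrite mxE.
- by apply: unitary_diag => j; rewrite mxE.
Qed.

(** Triangle inequality over the matrix units. It turns entrywise estimates into estimates of [N],
    for continuity and for the cubic remainder. *)
Lemma uin_le_sum (A : 'M[R[i]]_(p, q)) :
  N A <= \sum_j \sum_k cmod (A j k) * N (delta_mx j k).
Proof.
rewrite {1}[A]matrix_sum_delta.
have le_sum (J : finType) (F : J -> 'M[R[i]]_(p, q)) : N (\sum_j F j) <= \sum_j N (F j).
  elim/big_ind2: _ => [|a x b y ax bY|//]; first by rewrite uin0.
  exact: le_trans (uin_leD _ _) (lerD ax bY).
apply: le_trans (le_sum _ _) _; apply: ler_sum => j _.
apply: le_trans (le_sum _ _) _; apply: ler_sum => k _.
by case: uN => _ -> _ _.
Qed.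

Lemma cayley_neq0 (x : R) : 1 - I * rc x != 0.
Proof. by rewrite eq_complex /= negb_and; apply/orP; left; apply/eqP; lra. Qed.

Lemma cayley_unit (x : R) : (1 + I * rc x) / (1 - I * rc x) *
   ((1 + I * rc x) / (1 - I * rc x))^* = 1.
Proof.
have E : (1 + I * rc x)^* = 1 - I * rc x.
  by apply/eqP; rewrite eq_complex /=; apply/andP; split; apply/eqP; simpl; ring.
have E' : (1 - I * rc x)^* = 1 + I * rc x by rewrite -E conjCK.
have n1 : 1 - I * rc x != 0.
  by rewrite eq_complex /= negb_and; apply/orP; left; apply/eqP; lra.
have n2 : 1 + I * rc x != 0.
  by rewrite eq_complex /= negb_and; apply/orP; left; apply/eqP; lra.
rewrite fmorph_div /= E E'; by field; apply/andP; split; [exact: n2 | exact: n1].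
Qed.

(* The Cayley transforms of [r d] and [r e] are unitary, so [N (P + i r Q) = N (P - i r Q)]
   with [P := W + r^2 D W E] and [Q := D W - W E]; let [r] tend to [0]. *)
Lemma uin_le_sylvester (d : 'I_p -> R) (e : 'I_q -> R) (W : 'M[R[i]]_(p, q)) :
  N W <= N (\matrix_(j, k) ((1 + I * rc (d j - e k)) * W j k)).
Proof.
set Z := \matrix_(j, k) _.
pose K := \matrix_(j, k) (rc (d j * e k) * W j k) : 'M[R[i]]_(p, q).
suff H r : 0 < r <= 1 -> N W <= N Z + 2 * r * N K.
  apply/ler_addgt0Pr => e0 e00; have K0 : 0 < 2 * N K + 1 by have := uin_ge0 K; lra.
  pose r := Num.min 1 (e0 / (2 * N K + 1)).
  have r0 : 0 < r by rewrite lt_min ltr01 divr_gt0.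
  have r1 : r <= 1 by rewrite ge_min lexx.
  have rK : r * (2 * N K + 1) <= e0 by rewrite -ler_pdivlMr // ge_min lexx orbT.
  by have := H r; rewrite r0 r1 => /(_ isT); lra.
move=> /andP[r0 r1].
pose Ap := \matrix_(j, k) ((1 + I * rc (r * d j)) * (1 - I * rc (r * e k)) * W j k)
  : 'M[R[i]]_(p, q).
pose Am := \matrix_(j, k) ((1 - I * rc (r * d j)) * (1 + I * rc (r * e k)) * W j k)
  : 'M[R[i]]_(p, q).
have ApAm : N Ap = N Am.
  rewrite -(@uin_diag (fun j => (1 + I * rc (r * d j)) / (1 - I * rc (r * d j)))
    (fun k => (1 + I * rc (r * - e k)) / (1 - I * rc (r * - e k))) Am) //;
    try by move=> ?; apply: cayley_unit.
  congr N; apply/matrixP => j k; rewrite !mxE mulrN rmorphN /= mulrN opprK.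
  have n1 : 1 - I * rc (r * d j) != 0 := cayley_neq0 _.
  have n2 : 1 + I * rc (r * e k) != 0.
    by rewrite -[I * _]opprK -mulrN -rmorphN cayley_neq0.
  move: (rc (r * d j)) (rc (r * e k)) n1 n2 => x y n1 n2.
  by field; apply/andP; split.
have EW : rc 2 *: W = Ap + Am - rc (2 * r ^+ 2) *: K.
  apply/matrixP => j k; rewrite !mxE; apply/eqP; case: (W j k) => a b.
  by rewrite eq_complex /=; apply/andP; split; apply/eqP; ring.
(* [Z] is [W + i Q], so [Ap] contains [W] only with weight [1 - r]; compared with the bound on
   [2 W], a multiple [r N W] is left over. *)
have EA : Ap = rc (1 - r) *: W + rc r *: Z + rc (r ^+ 2) *: K.
  apply/matrixP => j k; rewrite !mxE; apply/eqP; case: (W j k) => a b.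
  by rewrite eq_complex /=; apply/andP; split; apply/eqP; ring.
have r2 : 0 <= r ^+ 2 by rewrite exprn_ge0 // ltW.
have h1 : 2 * N W <= 2 * N Ap + 2 * r ^+ 2 * N K.
  have -> : 2 * N W = N (rc 2 *: W) by rewrite uin_real ger0_norm.
  rewrite EW; apply: le_trans (uin_leD _ _) _; rewrite uinN uin_real ger0_norm; last by lra.
  by rewrite lerD2r; apply: le_trans (uin_leD _ _) _; rewrite ApAm; lra.
have h2 : N Ap <= (1 - r) * N W + r * N Z + r ^+ 2 * N K.
  rewrite EA; apply: le_trans (uin_leD _ _) _; rewrite uin_real ger0_norm // lerD2r.
  by apply: le_trans (uin_leD _ _) _; rewrite !uin_real !ger0_norm //; lra.
have : r * N W <= r * (N Z + 2 * r * N K) by rewrite !mulrDr !mulrA; lra.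
by rewrite ler_pM2l.
Qed.

(** The first-order inequality is used twice with opposite signs: [(1 + i x) (1 - i x) = 1 + x^2]
    for [x := sqrt a (d_j - e_k)]. *)
Lemma uin_le_sylvester2 (d : 'I_p -> R) (e : 'I_q -> R) (a : R) (W : 'M[R[i]]_(p, q)) :
  0 <= a ->
  N W <= N (\matrix_(j, k) (rc (1 + a * (d j - e k) ^+ 2) * W j k)).
Proof.
move=> a0; pose b := Num.sqrt a.
apply: le_trans (uin_le_sylvester (fun j => b * d j) (fun k => b * e k) W) _.
apply: le_trans (uin_le_sylvester (fun j => - (b * d j)) (fun k => - (b * e k)) _) _.
rewrite le_eqVlt; apply/orP; left; apply/eqP; congr N; apply/matrixP => j k.
rewrite !mxE mulrA; congr (_ * _); apply/eqP.
rewrite eq_complex /=; apply/andP; split; apply/eqP; last by ring.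
by rewrite -(sqr_sqrtr a0) -/b; ring.
Qed.
End UnitarilyInvariantNorm.

(** * Convexity of unitarily invariant norms along exponential paths *)

Section ExponentialPath.
Variables (R : realType) (p q : nat) (N : 'M[R[i]]_(p, q) -> R).
Hypothesis uN : unitarily_invariant_norm N.
Variables (d : 'I_p -> R) (e : 'I_q -> R) (B : 'M[R[i]]_(p, q)).
Local Notation rc := (real_complex R).

(** The path [e^{tD} B e^{-tE}] with [D] and [E] real diagonal. *)
Definition exp_path (t : R) : 'M[R[i]]_(p, q) :=
  \matrix_(j, k) (rc (expR (t * (d j - e k))) * B j k).

(** [N] of the difference bounds the difference of the norms, and its entrywise bound [g] tends to
    [0]. *)
Lemma uin_exp_path_continuous : continuous (fun t => N (exp_path t)).
Proof.
move=> x.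
pose g t := \sum_j \sum_k
  `|expR (t * (d j - e k)) - expR (x * (d j - e k))| * cmod (B j k) * N (delta_mx j k).
have Ng t : N (exp_path t - exp_path x) <= g t.
  apply: le_trans (uin_le_sum uN _) _; rewrite le_eqVlt; apply/orP; left; apply/eqP.
  apply: eq_bigr => j _; apply: eq_bigr => k _; congr (_ * _).
  by rewrite !mxE -mulrBl -rmorphB cmodM cmod_real.
have cg : g t @[t --> x] --> (0 : R).
  have -> : 0 = g x :> R.
    rewrite /g big1 // => j _; rewrite big1 // => k _.
    by rewrite subrr normr0 !mul0r.
  have cadd : continuous (fun y : R * R => y.1 + y.2) by exact: add_continuous.
  apply: (cvg_big cadd) => j _; apply: (cvg_big cadd) => k _.
  apply: cvgM; last exact: cvg_cst.
  apply: cvgM; last exact: cvg_cst.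
  apply: cvg_norm; apply: cvgB; last exact: cvg_cst.
  apply: continuous_cvg; first exact: continuous_expR.
  by apply: cvgM; [exact: cvg_id | exact: cvg_cst].
apply: (@squeeze_cvgr _ _ _ _ (fun t => N (exp_path x) - g t) (fun t => N (exp_path x) + g t)).
- near=> t; apply/andP; split.
    rewrite lerBlDr; apply: le_trans _ (lerD (lexx _) (Ng t)).
    rewrite -(uinN uN (_ - _)) opprB.
    by apply: le_trans (uin_leD uN _ _); rewrite addrC subrK.
  apply: le_trans _ (lerD (lexx _) (Ng t)).
  by apply: le_trans (uin_leD uN _ _); rewrite addrC subrK.
- rewrite -[X in _ --> X]subr0; apply: cvgB; [exact: cvg_cst | exact: cg].
- rewrite -[X in _ --> X]addr0; apply: cvgD; [exact: cvg_cst | exact: cg].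
Unshelve. all: by end_near.
Qed.

Lemma uin_exp_path_convex : convex_R (fun t => N (exp_path t)).
Proof.
(* [X] bounds every [|d_j - e_k|], so [h <= 1 / (X + 1)] brings all arguments into the range of
   [cosh_second_order]. *)
pose X := \sum_j \sum_k `|d j - e k|.
have X0 : 0 <= X by apply: sumr_ge0 => j _; apply: sumr_ge0 => k _.
have leX j k : `|d j - e k| <= X.
  rewrite /X (bigD1 j) //= (bigD1 k) //= -addrA lerDl addr_ge0 //.
    by apply: sumr_ge0.
  by apply: sumr_ge0 => ? _; apply: sumr_ge0.
pose K c := \sum_j \sum_k
  (4 * `|d j - e k| ^+ 3 * cmod (exp_path c j k) * N (delta_mx j k)).
apply: (@convex_R_of_second_difference _ _ K (X + 1)^-1) => [||c h /andP[h0 hX]].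
- exact: uin_exp_path_continuous.
- by rewrite invr_gt0; lra.
(* [2 T] is the second-order expansion of [S] in [h]. Dissipativity gives [N (exp_path c) <= N T],
   and [S] differs from [2 T] by a cubic error. *)
pose S := exp_path (c + h) + exp_path (c - h).
pose T := \matrix_(j, k) (rc (1 + 2^-1 * (h * d j - h * e k) ^+ 2) * exp_path c j k).
have leT : N (exp_path c) <= N T.
  by apply: (@uin_le_sylvester2 _ _ _ _ uN (fun j => h * d j) (fun k => h * e k)); rewrite invr_ge0.
have leS : N (rc 2 *: T - S) <= K c * h ^+ 3.
  apply: le_trans (uin_le_sum uN _) _; rewrite mulr_suml; apply: ler_sum => j _.
  rewrite mulr_suml; apply: ler_sum => k _.
  rewrite [leRHS]mulrAC ler_wpM2r ?(uin_ge0 uN) //.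
  set x := h * (d j - e k).
  have x1 : `|x| <= 1.
    rewrite normrM (gtr0_norm h0) -[leRHS](@mulVf _ (X + 1)); last by rewrite lt0r_neq0 //; lra.
    apply: ler_pM => //; first exact: ltW.
    by apply: le_trans (leX j k) _; lra.
  have -> : (rc 2 *: T - S) j k =
      - (rc (expR x + expR (- x) - 2 - x ^+ 2) * exp_path c j k).
    have e1 : expR ((c + h) * (d j - e k)) = expR (c * (d j - e k)) * expR x.
      by rewrite -expRD mulrDl.
    have e2 : expR ((c - h) * (d j - e k)) = expR (c * (d j - e k)) * expR (- x).
      by rewrite -expRD mulrBl.
    have e3 : 2 * (1 + 2^-1 * (h * d j - h * e k) ^+ 2) = 2 + x ^+ 2.
      by rewrite -mulrBr -/x; field.
    by rewrite !mxE e1 e2 mulrA -rmorphM e3; ring.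
  rewrite -mulNr -rmorphN cmodM cmod_real normrN.
  have := ler_wpM2r (cmod_ge0 (exp_path c j k)) (cosh_second_order x1).
  have -> : `|x| ^+ 3 = h ^+ 3 * `|d j - e k| ^+ 3.
    by rewrite normrM (gtr0_norm h0) exprMn.
  lra.
have : 2 * N T <= N (rc 2 *: T - S) + N S.
  have -> : 2 * N T = N (rc 2 *: T) by rewrite (uin_real uN) ger0_norm.
  by apply: le_trans (uin_leD uN _ _); rewrite subrK.
have := uin_leD uN (exp_path (c + h)) (exp_path (c - h)); rewrite -/S.
lra.
Qed.
End ExponentialPath.

(** The factor [e^{lt}] is absorbed by shifting [d] to [d + l], so the plain convexity result covers
    every [l]. For [B = 0] the function is constant. *)
Lemma uin_ln_exp_path_convex (R : realType) (p q : nat) (N : 'M[R[i]]_(p, q) -> R)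
    (d : 'I_p -> R) (e : 'I_q -> R) (B : 'M[R[i]]_(p, q)) :
  unitarily_invariant_norm N ->
  convex_R (fun t => ln (N (exp_path d e B t))).
Proof.
move=> uN; have [->|B0] := eqVneq B 0.
  have E t : exp_path d e 0 t = 0 by apply/matrixP => j k; rewrite !mxE mulr0.
  by move=> a b s _; rewrite !E -mulrDl subrK mul1r.
apply: convex_R_ln => [t|l].
  apply: (uin_gt0 uN); apply: contra_neq B0 => /matrixP E; apply/matrixP => j k.
  move/eqP: (E j k); rewrite !mxE mulf_eq0 => /orP[|/eqP //].
  by rewrite eq_complex /= gt_eqF ?expR_gt0.
have := uin_exp_path_convex uN (fun j => d j + l) e B.
congr convex_R; apply/funext => t.
rewrite -[expR (l * t)]ger0_norm ?expR_ge0 // -(uin_real uN); congr N.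
apply/matrixP => j k; rewrite !mxE mulrA -rmorphM -expRD; congr (real_complex R (expR _) * _).
by ring.
Qed.

(** * Exponentials of Hermitian matrices *)

Section HermitianExponential.
Variable R : realType.
Local Notation rc := (real_complex R).

Lemma unitary_unit (p : nat) (U : 'M[R[i]]_p) : unitary U -> U \in unitmx.
Proof. by move=> /mulmx1_unit []. Qed.

Lemma invmx_of_unitary (p : nat) (U : 'M[R[i]]_p) : unitary U -> invmx U = mxstar U.
Proof.
move=> uU; rewrite -[LHS]mulmx1 -uU mulmxA mulVmx ?mul1mx //; exact: unitary_unit.
Qed.

Lemma mxstarK (p q : nat) (A : 'M[R[i]]_(p, q)) : mxstar (mxstar A) = A.
Proof. by apply/matrixP => j k; rewrite !mxE conjCK. Qed.

Lemma unitary_star (p : nat) (U : 'M[R[i]]_p) : unitary U -> unitary (mxstar U).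
Proof.
by move=> uU; rewrite /unitary mxstarK -(invmx_of_unitary uU) mulVmx // unitary_unit.
Qed.

Lemma hermitian_diagonalization (p : nat) (H : 'M[R[i]]_p) : Defs.hermitian H ->
  exists (U : 'M[R[i]]_p) (d : 'rV[R]_p),
    unitary U /\ H = U *m diag_mx (map_mx rc d) *m mxstar U.
Proof.
move=> hH.
have hs : H \is hermsymmx.
  by apply/is_hermitianmxP; rewrite expr0 scale1r -{1}hH /mxstar map_trmx.
have uV : unitary (spectralmx H).
  by have /unitarymxP := spectral_unitarymx H; rewrite /unitary /mxstar map_trmx.
(* The spectral theorem gives [H = V^-1 D V], hence [U := V^*]; the eigenvalues are real, so taking
   real parts loses nothing. *)
exists (mxstar (spectralmx H)), (map_mx (@complex.Re R) (spectral_diag H)); split.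
  exact: unitary_star.
have /orthomx_spectralP {1}-> := hermitian_normalmx hs.
rewrite mxstarK (invmx_of_unitary uV); congr (_ *m diag_mx _ *m _).
apply/rowP => j; rewrite !mxE.
have /mxOverP /(_ 0 j) := hermitian_spectral_diag_real hs.
by move=> /RRe_real ->.
Qed.

(** A positive tolerance in [R[i]] is a real number, so convergence in [R] carries over. *)
Lemma exp_coeff_cvg_complex (x : R) :
  rc (series (exp_coeff x) n) @[n --> \oo] --> (rc (expR x) : (R[i] : numFieldType)).
Proof.
apply/(@cvgrPdist_lt _ (R[i] : numFieldType)) => e e0.
have e1 : 0 < complex.Re e by move: e0; rewrite ltcE => /andP[].
have eE : e = rc (complex.Re e) by rewrite RRe_real // gtr0_real.
have /cvgrPdist_lt /(_ _ e1) := @is_cvg_series_exp_coeff R x.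
apply: filterS => n h; rewrite eE -rmorphB.
have -> : `|rc (expR x - series (exp_coeff x) n)| = rc `|expR x - series (exp_coeff x) n|.
  by rewrite normc_def /= expr0n addr0 sqrtr_sqr.
by rewrite ltcR.
Qed.

(** Conjugation by [U] passes through powers and finite sums, so the partial sums are conjugated
    diagonal matrices of real exponential series; the limit is taken entrywise. *)
Lemma expm_hermitian (p : nat) (U : 'M[R[i]]_p) (d : 'rV[R]_p) (t : R) : unitary U ->
  expm (rc t *: (U *m diag_mx (map_mx rc d) *m mxstar U)) =
  U *m diag_mx (\row_j rc (expR (t * d 0 j))) *m mxstar U.
Proof.
move=> uU.
have VU : mxstar U *m U = 1%:M by have := unitary_star uU; rewrite /unitary mxstarK.
set D := diag_mx (map_mx rc d).
have powE k : (rc t *: (U *m D *m mxstar U)) ^+ k =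
    U *m diag_mx (\row_j rc ((t * d 0 j) ^+ k)) *m mxstar U.
  elim: k => [|k IH].
    rewrite expr0 -[LHS]uU; congr (_ *m _); rewrite -[LHS]mulmx1; congr (_ *m _).
    by rewrite -diag_const_mx; congr diag_mx; apply/rowP => j; rewrite !mxE expr0.
  rewrite exprSr IH -[_ * _]/(_ *m _) -scalemxAr !mulmxA.
  rewrite -(mulmxA _ (mxstar U) U) VU mulmx1 scalemxAl; congr (_ *m _).
  rewrite -mulmxA scalemxAr mulmx_diag -linearZ; congr (_ *m diag_mx _).
  by apply/rowP => j; rewrite !mxE exprSr !rmorphM /=; ring.
have serE n : series (fun k => (k`!%:R)^-1 *: (rc t *: (U *m D *m mxstar U)) ^+ k) n =
    U *m diag_mx (\row_j rc (series (exp_coeff (t * d 0 j)) n)) *m mxstar U.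
  rewrite /series /=; elim: n => [|n IH].
    rewrite big_geq //; apply/esym.
    have -> : (\row_j rc (\sum_(0 <= k < 0) exp_coeff (t * d 0 j) k)) = 0.
      by apply/rowP => j; rewrite !mxE big_geq.
    by rewrite linear0 mulmx0 mul0mx.
  rewrite big_nat_recr //= IH powE scalemxAl scalemxAr -mulmxDl -mulmxDr.
  rewrite -linearZ -linearD; congr (_ *m diag_mx _ *m _).
  apply/rowP => j; rewrite !mxE big_nat_recr //= rmorphD /=; congr (_ + _).
  by rewrite /exp_coeff /= rmorphM fmorphV rmorph_nat mulrC.
apply: (@cvg_lim ('M[R[i]]_p : normedModType R[i])); first exact: norm_hausdorff.
pose S n := U *m diag_mx (\row_j rc (series (exp_coeff (t * d 0 j)) n)) *m mxstar U.
pose L := U *m diag_mx (\row_j rc (expR (t * d 0 j))) *m mxstar U.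
rewrite -/L (_ : series _ = S); last exact/funext.
have cadd : continuous (fun y : (R[i] : numFieldType) * (R[i] : numFieldType) => y.1 + y.2).
  exact: add_continuous.
have cvgS j k : S n j k @[n --> \oo] --> (L j k : (R[i] : numFieldType)).
  rewrite mxE; under eq_cvg do rewrite mxE.
  apply: (cvg_big cadd) => l _; rewrite mul_mx_diag !mxE.
  under eq_cvg do rewrite mul_mx_diag !mxE.
  apply: cvgM; last exact: cvg_cst.
  apply: cvgM; first exact: cvg_cst.
  exact: exp_coeff_cvg_complex.
apply/cvg_ballP => e e0.
have : \forall n \near \oo, forall jk : 'I_p * 'I_p,
    ball (L jk.1 jk.2 : (R[i] : numFieldType)) e (S n jk.1 jk.2).
  apply: filter_forall => -[j k] /=.
  by have /(@cvg_ballP _ (R[i] : numFieldType)) /(_ e e0) := cvgS j k.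
by apply: filterS => n h; split => // j k; exact: (h (j, k)).
Qed.
End HermitianExponential.

(** * Inverses, and unitarily invariant norms along geodesics *)

Lemma diag_mxV (F : fieldType) (p : nat) (u : 'rV[F]_p) : (forall j, u 0 j != 0) ->
  diag_mx u *m diag_mx (\row_j (u 0 j)^-1) = 1%:M.
Proof.
move=> u0; rewrite mulmx_diag -diag_const_mx; congr diag_mx.
by apply/rowP => j; rewrite !mxE mulfV.
Qed.

Lemma invmx_eq (F : fieldType) (p : nat) (A B : 'M[F]_p) : A *m B = 1%:M -> invmx A = B.
Proof.
move=> AB; have [uA _] := mulmx1_unit AB.
by rewrite -[LHS]mulmx1 -AB mulmxA mulVmx // mul1mx.
Qed.

Lemma mul_invmx (F : fieldType) (p : nat) (A B : 'M[F]_p) :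
  A \in unitmx -> B \in unitmx -> invmx (A *m B) = invmx B *m invmx A.
Proof.
move=> uA uB; apply: invmx_eq.
by rewrite mulmxA -(mulmxA A) mulmxV // mulmx1 mulmxV.
Qed.

Section Geodesics.
Variable R : realType.
Local Notation rc := (real_complex R).

Lemma unitaryVC (p : nat) (U : 'M[R[i]]_p) : unitary U -> mxstar U *m U = 1%:M.
Proof. by move=> /unitary_star; rewrite /unitary mxstarK. Qed.

Lemma invmx_expm_hermitian (p : nat) (U : 'M[R[i]]_p) (d : 'rV[R]_p) (t : R) : unitary U ->
  invmx (expm (rc t *: (U *m diag_mx (map_mx rc d) *m mxstar U))) =
  U *m diag_mx (\row_j rc (expR (- (t * d 0 j)))) *m mxstar U.
Proof.
move=> uU; rewrite expm_hermitian //; apply: invmx_eq.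
rewrite !mulmxA -(mulmxA _ (mxstar U) U) unitaryVC // mulmx1.
rewrite -(mulmxA U) mulmx_diag (_ : (\row_i _) = const_mx 1).
  by rewrite diag_const_mx mulmx1.
by apply/rowP => j; rewrite !mxE -rmorphM -expRD subrr expR0.
Qed.

Lemma expm_hermitian_unit (p : nat) (H : 'M[R[i]]_p) (t : R) : Defs.hermitian H ->
  expm (rc t *: H) \in unitmx.
Proof.
move=> /hermitian_diagonalization [U [d [uU ->]]].
rewrite expm_hermitian // !unitmx_mul (unitary_unit uU) (unitary_unit (unitary_star uU)) andbT /=.
have u0 j : (\row_j rc (expR (t * d 0 j))) 0 j != 0.
  by rewrite mxE eq_complex /= gt_eqF ?expR_gt0.
by have [] := mulmx1_unit (diag_mxV u0).
Qed.

(** After diagonalisation the outer unitaries drop by invariance and the inner ones are absorbed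
    into [B], leaving the exponential path of [U^* B V]. *)
Lemma uin_ln_geodesic_convex (p q : nat) (N : 'M[R[i]]_(p, q) -> R)
    (H1 : 'M[R[i]]_p) (H2 : 'M[R[i]]_q) (B : 'M[R[i]]_(p, q)) :
  unitarily_invariant_norm N -> Defs.hermitian H1 -> Defs.hermitian H2 ->
  convex_R (fun t => ln (N (expm (rc t *: H1) *m B *m invmx (expm (rc t *: H2))))).
Proof.
move=> uN /hermitian_diagonalization [U [d [uU ->]]].
move=> /hermitian_diagonalization [V [e [uV ->]]].
have := uin_ln_exp_path_convex (fun j => d 0 j) (fun k => e 0 k)
  (mxstar U *m B *m V) uN.
congr convex_R; apply/funext => t; congr ln.
case: uN => _ _ _ inv; rewrite -[LHS](inv U (mxstar V)) //; last exact: unitary_star.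
congr N; rewrite expm_hermitian // invmx_expm_hermitian // !mulmxA.
set D1 := diag_mx _; set D2 := diag_mx _.
rewrite (_ : U *m _ *m _ *m _ *m _ *m _ *m _ = U *m (D1 *m (mxstar U *m B *m V) *m D2) *m mxstar V);
  last by rewrite !mulmxA.
congr (_ *m _ *m _); move: (mxstar U *m B *m V) => C.
rewrite mul_mx_diag mul_diag_mx; apply/matrixP => j k; rewrite !mxE.
by rewrite mulrAC -rmorphM -expRD mulrBr.
Qed.

End Geodesics.

(** * The pseudoinverse term on cosets and geodesics *)

Section ConditionNumber.
Variables (R : realType) (m n : nat).
Local Notation rc := (real_complex R).
Variable G : set ('M[R[i]]_m * 'M[R[i]]_n).
Hypothesis symG : symmetric_subgroup G.

Lemma G_unit g : G g -> g.1 \in unitmx /\ g.2 \in unitmx.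
Proof. by case: symG => -[+ _ _ _] _ _; apply. Qed.

Lemma convex_RD (f g : R -> R) : convex_R f -> convex_R g -> convex_R (fun t => f t + g t).
Proof.
move=> cf cg a b s s01; apply: le_trans (lerD (cf a b s s01) (cg a b s s01)) _.
by rewrite !mulrDr addrACA.
Qed.

Lemma ln_add_congr (a b c d : R) : a = c -> b = d -> ln a + ln b = ln c + ln d.
Proof. by move=> -> ->. Qed.

(** [P] stands for the pseudoinverse of [A] or of the Jacobian; the unitary factors coming from [k]
    end up on the outer sides. *)
Lemma pinv_term_invariant (N2 : 'M[R[i]]_(n, m) -> R) (P : 'M[R[i]]_(n, m)) k g :
  unitarily_invariant_norm N2 -> Kof G k -> G g ->
  N2 (k.2 *m g.2 *m P *m invmx (k.1 *m g.1)) = N2 (g.2 *m P *m invmx g.1).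
Proof.
move=> [_ _ _ inv] [_ [k1 k2]] /G_unit[g1 g2].
rewrite (mul_invmx (unitary_unit k1) g1) (invmx_of_unitary k1) -[RHS](inv k.2 (mxstar k.1)) //.
  by rewrite !mulmxA.
exact: unitary_star.
Qed.

(** The matrix is [n] by [m], so [H.2] acts on the left and [H.1], inverted, on the right. *)
Lemma pinv_term_convex (N2 : 'M[R[i]]_(n, m) -> R) (P : 'M[R[i]]_(n, m)) g H :
  unitarily_invariant_norm N2 -> G g -> iLieK G H ->
  convex_R (fun t => ln (N2 (expm (rc t *: H.2) *m g.2 *m P *m
                             invmx (expm (rc t *: H.1) *m g.1)))).
Proof.
move=> uN /G_unit[g1 g2] [_ [h1 h2]].
have := uin_ln_geodesic_convex (g.2 *m P *m invmx g.1) uN h2 h1.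
congr convex_R; apply/funext => t; congr (ln (N2 _)).
by rewrite (mul_invmx (expm_hermitian_unit t h1) g1) !mulmxA.
Qed.
End ConditionNumber.

(** * Linear substitutions and the Bombieri-Weyl product *)

Import mpoly.

Section MpolyInduction.
Variables (n : nat) (C : comNzRingType).

(** The induction step is multiplication by a variable, the operation adjoint to a partial
    derivative. Monomials are reached by induction on the degree. *)
Lemma mpoly_ind_mulX (P : mpoly n C -> Prop) :
  P 1 -> (forall c p, P p -> P (c *: p)) -> (forall p q, P p -> P q -> P (p + q)) ->
  (forall i p, P p -> P (@mpolyX n C (mnm1 i) * p)) -> forall p, P p.
Proof.
move=> P1 PZ PD PX.
have PXm k (a : multinom n) : (mdeg a <= k)%N -> P (mpolyX C a).
  elim: k a => [|k IH] a.
    by rewrite leqn0 mdeg_eq0 => /eqP ->; rewrite mpolyX0.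
  have [->|a0] := eqVneq a mnm0; first by rewrite mpolyX0.
  have [i ai] : exists i, (0 < a i)%N.
    apply/existsP; apply: contra_neqT a0 => /existsPn a0; apply/mnmP => i.
    by rewrite mnm0E; apply/eqP; rewrite -leqn0 leqNgt a0.
  have -> : a = mnm_add (mnm1 i) (mnm_sub a (mnm1 i)).
    apply/mnmP => j; rewrite mnmDE mnmBE mnm1E; case: eqP => [<-|] /=; last by rewrite subn0.
    by rewrite addnC subnK.
  by rewrite mdegD mdeg1 add1n ltnS mpolyXD => ?; apply/PX/IH.
elim/mpolyind => [|c a p _ _ Pp]; first by rewrite -(scale0r 1); apply: PZ.
by apply: PD => //; apply: PZ; apply: PXm (leqnn _).
Qed.
End MpolyInduction.

Section LinearSubstitution.
Variables (C : numClosedFieldType) (n : nat).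
Local Notation poly := (mpoly.mpoly n C).
Local Notation X := (@mpolyX n C).
Implicit Types (p q : poly) (B : 'M[C]_n).

(* [linsubst] over an abstract field: unification on polynomials over the concrete
   [R[i]] unfolds complex arithmetic and diverges. *)
Definition lsubst B : n.-tuple poly := [tuple \sum_(k < n) B j k *: X (mnm1 k) | j < n].

Lemma comp_lsubstX B i : comp_mpoly (lsubst B) (X (mnm1 i)) = \sum_k B i k *: X (mnm1 k).
Proof. by rewrite comp_mpolyXU -tnth_nth tnth_mktuple. Qed.

(** Both sides are multiplicative and linear in [p], so the variables decide. The substitution made
    first is the left factor. *)
Lemma comp_lsubst_lsubst A B p :
  comp_mpoly (lsubst B) (comp_mpoly (lsubst A) p) = comp_mpoly (lsubst (A *m B)) p.
Proof.
elim/mpoly_ind_mulX: p => [|c p IH|p q IHp IHq|i p IH].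
- by rewrite !rmorph1.
- by rewrite !linearZ /= IH.
- by rewrite !comp_mpolyD IHp IHq.
rewrite !rmorphM /= IH !comp_lsubstX; congr (_ * _).
rewrite linear_sum /=.
under eq_bigr do rewrite linearZ /= comp_lsubstX scaler_sumr.
rewrite exchange_big /=; apply: eq_bigr => k _; rewrite mxE scaler_suml.
by apply: eq_bigr => l _; rewrite scalerA.
Qed.

Lemma comp_lsubst1 p : comp_mpoly (lsubst 1%:M) p = p.
Proof.
rewrite -[RHS]comp_mpoly_id; congr comp_mpoly; apply: eq_from_tnth => i.
rewrite !tnth_mktuple (bigD1 i) //= big1 ?addr0; first by rewrite mxE eqxx scale1r.
by move=> k ki; rewrite mxE eq_sym (negPf ki) scale0r.
Qed.

Lemma mderiv_mpolyU (i j : 'I_n) : mderiv i (X (mnm1 j)) = (i == j)%:R.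
Proof.
rewrite mderivX mnm1E eq_sym; case: eqP => [->|] /=; last by rewrite scale0r.
by rewrite scale1r -mpolyX0; congr mpolyX; apply/mnmP => k; rewrite mnmBE subnn mnm0E.
Qed.

(** Chain rule for a linear substitution, by the Leibniz rule on [x_i p]. *)
Lemma mderiv_comp_lsubst B j p :
  mderiv j (comp_mpoly (lsubst B) p) =
  \sum_k B k j *: comp_mpoly (lsubst B) (mderiv k p).
Proof.
elim/mpoly_ind_mulX: p => [|c p IH|p q IHp IHq|i p IH].
- rewrite rmorph1 -mpolyC1 mderivC big1 // => k _.
  by rewrite mderivC comp_mpoly0 scaler0.
- rewrite !linearZ /= IH scaler_sumr; apply: eq_bigr => k _.
  by rewrite !linearZ /= !scalerA mulrC.
- rewrite comp_mpolyD !mderivD IHp IHq -big_split /=; apply: eq_bigr => k _.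
  by rewrite mderivD comp_mpolyD scalerDr.
rewrite rmorphM /= mderivM IH comp_lsubstX linear_sum /=.
under eq_bigr do rewrite linearZ /= mderiv_mpolyU.
under [RHS]eq_bigr do
  rewrite mderivM mderiv_mpolyU comp_mpolyD !rmorphM /= rmorph_nat comp_lsubstX scalerDr.
rewrite [RHS]big_split /=; congr (_ + _).
  rewrite (bigD1 j) //= big1 ?addr0; last first.
    by move=> k kj; rewrite eq_sym (negPf kj) scaler0.
  rewrite (bigD1 i) //= [X in _ = _ + X]big1 ?addr0; last first.
    by move=> k ki; rewrite (negPf ki) mul0r scaler0.
  by rewrite !eqxx mul1r -scalerAl mul1r.
by rewrite mulr_sumr; apply: eq_bigr => k _; rewrite -scalerAr.
Qed.

(** Linear forms have no constant term. This is the base case [p = 1] of the adjointness in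
    [fischer_comp]. *)
Lemma mcoeff0_comp_lsubst B p : mcoeff mnm0 (comp_mpoly (lsubst B) p) = mcoeff mnm0 p.
Proof.
have XU0 i : mcoeff mnm0 (X (mnm1 i)) = 0 by rewrite mcoeffX mnm1_eq0.
elim/mpoly_ind_mulX: p => [|c p IH|p q IHp IHq|i p IH].
- by rewrite rmorph1.
- by rewrite linearZ /= !mcoeffZ IH.
- by rewrite comp_mpolyD !mcoeffD IHp IHq.
rewrite rmorphM /= !rmorphM /= XU0 comp_lsubstX linear_sum /= big1 ?mul0r //.
by move=> k _; rewrite mcoeffZ XU0 mulr0.
Qed.

Lemma mcoeff_comp_lsubst_diag (v : 'rV[C]_n) p a :
  mcoeff a (comp_mpoly (lsubst (diag_mx v)) p) = (\prod_k v 0 k ^+ a k) * mcoeff a p.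
Proof.
have Xv i : tnth (lsubst (diag_mx v)) i = v 0 i *: X (mnm1 i).
  rewrite tnth_mktuple (bigD1 i) //= big1 ?addr0; first by rewrite mxE eqxx.
  by move=> k ki; rewrite mxE eq_sym (negPf ki) mulr0n scale0r.
elim/mpolyind: p => [|c b p _ _ IH].
  by rewrite comp_mpoly0 !mcoeff0 mulr0.
rewrite comp_mpolyD !mcoeffD IH mulrDr; congr (_ + _).
rewrite comp_mpolyZ !mcoeffZ comp_mpolyX.
have -> : \prod_i tnth (lsubst (diag_mx v)) i ^+ b i = (\prod_i v 0 i ^+ b i) *: X b.
  rewrite (mpolyXE_id C b) -scaler_prod; apply: eq_bigr => i _.
  by rewrite Xv exprZn.
rewrite mcoeffZ mcoeffX mulrCA.
by case: eqP => [->//|]; rewrite !mulr0.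
Qed.

(** * The weighted Fischer product and adjoints of substitutions *)

Section Fischer.

Definition mfact (a : multinom n) : nat := (\prod_(j < n) (a j)`!)%N.

(* The weight [w] depends on the degree only, so that [w := 1] is the Fischer product
   and [w e := 1 / e!] the Bombieri-Weyl product. *)
Definition fischer (w : nat -> C) p q : C :=
  \sum_(a <- msupp p) mcoeff a p * (mcoeff a q)^* * ((mfact a)%:R * w (mdeg a)).

(** Coefficients vanish off the support, so polynomials with different supports can share one index
    list. *)
Lemma fischer_supp w p q (s : seq (multinom n)) : uniq s -> {subset msupp p <= s} ->
  fischer w p q =
  \sum_(a <- s) mcoeff a p * (mcoeff a q)^* * ((mfact a)%:R * w (mdeg a)).
Proof.
move=> us ps; rewrite [RHS](bigID (fun a => a \in msupp p)) /= [X in _ + X]big1 ?addr0.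
  rewrite -big_filter; apply: perm_big; apply: uniq_perm; rewrite ?filter_uniq ?msupp_uniq //.
  move=> a; rewrite mem_filter; apply/idP/idP => [ap|/andP[]//].
  by rewrite ap ps.
by move=> a /memN_msupp_eq0 ->; rewrite !mul0r.
Qed.

Lemma fischerDl w p p' q : fischer w (p + p') q = fischer w p q + fischer w p' q.
Proof.
pose s := undup (msupp p ++ msupp p').
have us : uniq s by exact: undup_uniq.
rewrite !(@fischer_supp w _ q s) // -?big_split /=.
- by apply: eq_bigr => a _; rewrite mcoeffD !mulrDl.
- by move=> a ap; rewrite mem_undup mem_cat ap orbT.
- by move=> a ap; rewrite mem_undup mem_cat ap.
- by move=> a /msuppD_le; rewrite mem_undup.
Qed.

Lemma fischerZl w c p q : fischer w (c *: p) q = c * fischer w p q.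
Proof.
rewrite (@fischer_supp w (c *: p) q (msupp p)) ?msupp_uniq //; last exact: msuppZ_le.
by rewrite mulr_sumr; apply: eq_bigr => a _; rewrite mcoeffZ !mulrA.
Qed.

Lemma fischer0l w q : fischer w 0 q = 0.
Proof. by rewrite -(scale0r 0) fischerZl mul0r. Qed.

Lemma fischer_suml w (I : Type) (r : seq I) (F : I -> poly) q :
  fischer w (\sum_(j <- r) F j) q = \sum_(j <- r) fischer w (F j) q.
Proof.
elim: r => [|j r IH]; first by rewrite !big_nil fischer0l.
by rewrite !big_cons fischerDl IH.
Qed.

Lemma fischerZr w c p q : fischer w p (c *: q) = c^* * fischer w p q.
Proof.
rewrite /fischer mulr_sumr; apply: eq_bigr => a _.
by rewrite mcoeffZ rmorphM /=; ring.
Qed.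

Lemma fischer_sumr w (I : Type) (r : seq I) p (F : I -> poly) :
  fischer w p (\sum_(j <- r) F j) = \sum_(j <- r) fischer w p (F j).
Proof.
rewrite /fischer exchange_big /=; apply: eq_bigr => a _.
by rewrite linear_sum /= rmorph_sum /= mulr_sumr mulr_suml.
Qed.

Lemma fischerX w a q : fischer w (X a) q = (mcoeff a q)^* * ((mfact a)%:R * w (mdeg a)).
Proof. by rewrite /fischer msuppX big_seq1 mcoeffX eqxx mul1r. Qed.

Lemma mfactS a j : mfact (mnm_add (mnm1 j) a) = ((a j).+1 * mfact a)%N.
Proof.
rewrite /mfact (bigD1 j) //= [in RHS](bigD1 j) //= mnmDE mnm1E eqxx factS mulnA.
congr (_ * _)%N; apply: eq_bigr => k kj.
by rewrite mnmDE mnm1E eq_sym (negPf kj).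
Qed.

(** On monomials, the factor [a_j + 1] gained by the factorial is the one produced by
    differentiation. The weight shifts because the degree drops by one. *)
Lemma fischer_mulX w j p q :
  fischer w (X (mnm1 j) * p) q = fischer (fun e => w e.+1) p (mderiv j q).
Proof.
elim/mpolyind: p => [|c a p _ _ IH]; first by rewrite mulr0 !fischer0l.
rewrite mulrDr !fischerDl IH -scalerAr !fischerZl -mpolyXD !fischerX.
congr (_ * _ + _); rewrite mfactS mdegD mdeg1 add1n mcoeff_deriv.
by rewrite [mnm_add a _]addmC rmorphMn /= natrM -mulr_natl; ring.
Qed.

(** Multiplication by [x_i] becomes a derivative of [q], to which the chain rule applies. This step
    changes [w] and [q], so both stay general in the induction. *)
Lemma fischer_comp w B p q :
  fischer w (comp_mpoly (lsubst B) p) q =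
  fischer w p (comp_mpoly (lsubst ((map_mx Num.conj B)^T)) q).
Proof.
elim/mpoly_ind_mulX: p w q => [|c p IH|p p' IHp IHp'|i p IH] w q.
- by rewrite rmorph1 -mpolyX0 !fischerX mcoeff0_comp_lsubst.
- by rewrite linearZ /= !fischerZl IH.
- by rewrite comp_mpolyD !fischerDl IHp IHp'.
rewrite rmorphM /= comp_lsubstX mulr_suml fischer_suml fischer_mulX.
rewrite mderiv_comp_lsubst fischer_sumr; apply: eq_bigr => k _.
by rewrite -scalerAl fischerZl fischer_mulX IH fischerZr !mxE conjCK.
Qed.
End Fischer.
End LinearSubstitution.

(** * The action on polynomial systems and its unitary invariance *)

Section SystemAction.
Variables (C : numClosedFieldType) (m n : nat).
Local Notation poly := (mpoly.mpoly n C).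
Implicit Types (X : 'M[C]_m) (Y : 'M[C]_n) (f : 'I_m -> poly).

Lemma bw_poly_fischer (p q : poly) :
  \sum_(a <- undup (msupp p ++ msupp q)) mcoeff a p * (mcoeff a q)^* *
    ((\prod_(j < n) (a j)`!)%:R / (mdeg a)`!%:R) = fischer (fun e => e`!%:R^-1) p q.
Proof.
rewrite (@fischer_supp _ _ _ _ _ (undup (msupp p ++ msupp q))) ?undup_uniq //.
by move=> a ap; rewrite mem_undup mem_cat ap.
Qed.

(** The action [sys_act] over an abstract field; on [R[i]] the two agree by computation. *)
Definition lact X Y f : 'I_m -> poly :=
  fun i => \sum_j X i j *: comp_mpoly (lsubst (invmx Y)) (f j).

Definition sys_fischer f : C := \sum_i fischer (fun e => e`!%:R^-1) (f i) (f i).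

(** Inversion reverses [Y Y'] and substitution reverses it again, so this is a left action. *)
Lemma lactM X X' Y Y' f : Y \in unitmx -> Y' \in unitmx ->
  lact (X *m X') (Y *m Y') f = lact X Y (lact X' Y' f).
Proof.
move=> uY uY'; apply/funext => i; rewrite /lact (mul_invmx uY uY').
transitivity (\sum_j \sum_k (X i j * X' j k) *:
    comp_mpoly (lsubst (invmx Y' *m invmx Y)) (f k)).
  rewrite exchange_big /=; apply: eq_bigr => k _.
  by rewrite mxE scaler_suml.
apply: eq_bigr => j _. rewrite (raddf_sum (comp_mpoly _)) scaler_sumr; apply: eq_bigr => k _.
by rewrite /= linearZ /= scalerA comp_lsubst_lsubst.
Qed.

(** Substitution by [Y^-1] has as adjoint the substitution by its conjugate transpose, which is its
    inverse; the mixing of components by [X] cancels through [X^* X = 1]. *)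
Lemma sys_fischer_unitary X Y f :
  X *m (map_mx Num.conj X)^T = 1%:M -> Y *m (map_mx Num.conj Y)^T = 1%:M ->
  sys_fischer (lact X Y f) = sys_fischer f.
Proof.
move=> uX uY.
have XX : (map_mx Num.conj X)^T *m X = 1%:M := mulmx1C uX.
have iY : invmx Y = (map_mx Num.conj Y)^T by apply: invmx_eq.
have YY : invmx Y *m (map_mx Num.conj (invmx Y))^T = 1%:M.
  rewrite iY -map_trmx trmxK -map_mx_comp (map_mx_id (@conjCK _)).
  exact: mulmx1C.
have cY p q : fischer (fun e => e`!%:R^-1) (comp_mpoly (lsubst (invmx Y)) p)
    (comp_mpoly (lsubst (invmx Y)) q) = fischer (fun e => e`!%:R^-1) p q.
  by rewrite fischer_comp comp_lsubst_lsubst YY comp_lsubst1.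
rewrite /sys_fischer /lact.
under eq_bigr => i _.
  rewrite fischer_suml.
  under eq_bigr => j _ do rewrite fischer_sumr.
  over.
under eq_bigr => i _ do under eq_bigr => j _ do under eq_bigr => k _ do
  rewrite fischerZl fischerZr cY mulrA.
(* The coefficient of the product of [f_j] and [f_k] is now an entry of [X^* X], so only [k = j]
   survives. *)
rewrite exchange_big /=; apply: eq_bigr => j _.
rewrite exchange_big /= (bigD1 j) //= [X in _ + X]big1 ?addr0.
  rewrite -mulr_suml -[RHS]mul1r; congr (_ * _).
  have /matrixP /(_ j j) := XX; rewrite !mxE eqxx => E; rewrite -[RHS]E.
  by apply: eq_bigr => i _; rewrite !mxE mulrC.
move=> k kj; rewrite -mulr_suml.
have /matrixP /(_ k j) := XX; rewrite !mxE (negPf kj) => E.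
rewrite (_ : \sum_i _ = 0) ?mul0r // -[RHS]E.
by apply: eq_bigr => i _; rewrite !mxE mulrC.
Qed.

Lemma mcoeff_lact_diag (u : 'rV[C]_m) (v : 'rV[C]_n) f i a : (forall k, v 0 k != 0) ->
  mcoeff a (lact (diag_mx u) (diag_mx v) f i) =
  u 0 i * (\prod_k (v 0 k)^-1 ^+ a k) * mcoeff a (f i).
Proof.
move=> v0; rewrite /lact (invmx_eq (diag_mxV v0)) (bigD1 i) //= big1 ?addr0.
  rewrite mcoeffZ mcoeff_comp_lsubst_diag mxE eqxx mulr1n mulrA.
  by congr (_ * _ * _); apply: eq_bigr => k _; rewrite mxE.
by move=> j ji; rewrite mxE eq_sym (negPf ji) mulr0n scale0r.
Qed.

Lemma sys_fischer_diag (u : 'rV[C]_m) (v : 'rV[C]_n) f : (forall k, v 0 k != 0) ->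
  sys_fischer (lact (diag_mx u) (diag_mx v) f) =
  \sum_i \sum_(a <- msupp (f i)) `|u 0 i * (\prod_k (v 0 k)^-1 ^+ a k) * mcoeff a (f i)| ^+ 2 *
    ((mfact a)%:R / (mdeg a)`!%:R).
Proof.
move=> v0; apply: eq_bigr => i _.
rewrite (@fischer_supp _ _ _ _ _ (msupp (f i))) ?msupp_uniq //.
  by apply: eq_bigr => a _; rewrite (mcoeff_lact_diag _ _ _ _ v0) normCK.
move=> a; rewrite !mcoeff_msupp (mcoeff_lact_diag _ _ _ _ v0).
by apply: contraNneq => ->; rewrite mulr0.
Qed.
End SystemAction.

Section BombieriWeyl.
Variables (R : realType) (m n : nat).
Local Notation rc := (real_complex R).
Local Notation poly := (mpoly.mpoly n R[i]).
Implicit Types (f : 'I_m -> poly).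

Lemma sys_actE (g : 'M[R[i]]_m * 'M[R[i]]_n) f : sys_act g f = lact g.1 g.2 f.
Proof. by []. Qed.

Lemma bw_normE f : bw_norm f = Num.sqrt (complex.Re (sys_fischer f)).
Proof.
rewrite /bw_norm /bw_inner /sys_fischer; congr (Num.sqrt (complex.Re _)).
by apply: eq_bigr => i _; exact: bw_poly_fischer.
Qed.

Lemma sys_actM (X X' : 'M[R[i]]_m) (Y Y' : 'M[R[i]]_n) f : Y \in unitmx -> Y' \in unitmx ->
  sys_act (X *m X', Y *m Y') f = sys_act (X, Y) (sys_act (X', Y') f).
Proof. exact: lactM. Qed.

Lemma bw_norm_unitary (X : 'M[R[i]]_m) (Y : 'M[R[i]]_n) f : unitary X -> unitary Y ->
  bw_norm (sys_act (X, Y) f) = bw_norm f.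
Proof. by move=> uX uY; rewrite !bw_normE sys_actE (sys_fischer_unitary _ uX uY). Qed.
End BombieriWeyl.

(** * Log-convexity of the Bombieri-Weyl norm along geodesics *)

Section ExponentialSums.
Variable R : realType.

(** Average the tangent-line bounds at the intermediate exponent [M]; the linear terms cancel. *)
Lemma convex_expR_line (l : R) : convex_R (fun t => expR (l * t)).
Proof.
move=> a b s /andP[s0 s1]; set M := l * _.
have tangent x : expR M * (1 + (x - M)) <= expR x.
  have -> : expR x = expR M * expR (x - M) by rewrite -expRD addrC subrK.
  by rewrite ler_pM2l ?expR_gt0 // expR_ge1Dx.
apply: le_trans (lerD (ler_wpM2l _ (tangent (l * a))) (ler_wpM2l _ (tangent (l * b)))) => //.
  by rewrite le_eqVlt; apply/orP; left; apply/eqP; rewrite /M; ring.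
by rewrite subr_ge0.
Qed.

Lemma convex_R_sum (I : Type) (r : seq I) (F : I -> R -> R) :
  (forall i, convex_R (F i)) -> convex_R (fun t => \sum_(i <- r) F i t).
Proof.
move=> cF; elim: r => [|i r IH] a b s s01.
  by rewrite !big_nil !mulr0 addr0.
rewrite !big_cons; apply: le_trans (lerD (cF i _ _ _ s01) (IH _ _ _ s01)) _.
by rewrite !mulrDr addrACA.
Qed.

Lemma convex_RZ (c : R) (f : R -> R) : 0 <= c -> convex_R f -> convex_R (fun t => c * f t).
Proof.
move=> c0 cf a b s s01; apply: le_trans (ler_wpM2l c0 (cf _ _ _ s01)) _.
by rewrite mulrDr !(mulrCA c).
Qed.

(** A factor [e^{kt}] only shifts the exponents, so [convex_R_ln] reduces the claim to single
    exponentials. If all coefficients vanish, the function is constant. *)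
Lemma ln_exp_sum_convex (I : eqType) (r : seq I) (c l : I -> R) : (forall i, 0 <= c i) ->
  convex_R (fun t => ln (\sum_(i <- r) c i * expR (l i * t))).
Proof.
move=> c0; have [/allP r0|] := boolP (all (fun i => c i == 0) r).
  have E t : \sum_(i <- r) c i * expR (l i * t) = 0.
    by rewrite big_seq big1 // => i /r0 /eqP ->; rewrite mul0r.
  by move=> a b s _; rewrite !E -mulrDl subrK mul1r.
move=> /allPn [i ir ci]; apply: convex_R_ln => [t|k].
  rewrite (big_rem i ir) /= ltr_wpDr //.
    by apply: sumr_ge0 => j _; rewrite mulr_ge0 ?expR_ge0.
  by rewrite mulr_gt0 ?expR_gt0 // lt_neqAle eq_sym ci c0.
rewrite (_ : (fun _ => _) = fun t => \sum_(i <- r) c i * expR ((k + l i) * t)).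
  by apply: convex_R_sum => j; apply: convex_RZ => //; exact: convex_expR_line.
apply/funext => t; rewrite mulr_sumr; apply: eq_bigr => j _.
by rewrite mulrDl expRD mulrCA.
Qed.

Lemma ln_sqrt (x : R) : 0 <= x -> ln (Num.sqrt x) = 2^-1 * ln x.
Proof.
rewrite le_eqVlt => /predU1P[<-|x0]; first by rewrite sqrtr0 ln0 // mulr0.
rewrite -{2}(sqr_sqrtr (ltW x0)) lnXn ?sqrtr_gt0 // -[ln _ *+ 2]mulr_natl.
by rewrite mulrA mulVf ?mul1r.
Qed.
End ExponentialSums.

Section BombieriWeylGeodesics.
Variables (R : realType) (m n : nat).
Local Notation rc := (real_complex R).
Local Notation poly := (mpoly.mpoly n R[i]).

Lemma norm_cmod (z : R[i]) : `|z| = rc (cmod z).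
Proof. by case: z. Qed.

(** Each exponent is twice the weight of [x^a] in component [i]; [e] enters negatively because [Y]
    acts through [Y^-1]. *)
Lemma bw_norm_diag_exp (d : 'rV[R]_m) (e : 'rV[R]_n) (f : 'I_m -> poly) (t : R) :
  bw_norm (sys_act (diag_mx (\row_j rc (expR (t * d 0 j))),
                    diag_mx (\row_k rc (expR (t * e 0 k)))) f) =
  Num.sqrt (\sum_i \sum_(a <- msupp (f i))
    cmod (mcoeff a (f i)) ^+ 2 * ((mfact a)%:R / (mdeg a)`!%:R) *
    expR (2 * (d 0 i - \sum_k (a k)%:R * e 0 k) * t)).
Proof.
rewrite bw_normE sys_actE sys_fischer_diag; last first.
  by move=> k; rewrite mxE eq_complex /= gt_eqF ?expR_gt0.
rewrite (_ : \sum_i _ = rc (\sum_i \sum_(a <- msupp (f i))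
    cmod (mcoeff a (f i)) ^+ 2 * ((mfact a)%:R / (mdeg a)`!%:R) *
    expR (2 * (d 0 i - \sum_k (a k)%:R * e 0 k) * t))) //.
rewrite rmorph_sum; apply: eq_bigr => i _.
rewrite rmorph_sum; apply: eq_bigr => a _ /=.
have -> : (\row_j rc (expR (t * d 0 j))) 0 i *
    (\prod_k ((\row_k rc (expR (t * e 0 k))) 0 k)^-1 ^+ a k) =
    rc (expR (t * (d 0 i - \sum_k (a k)%:R * e 0 k))).
  rewrite mulrBr expRD rmorphM /= mxE; congr (_ * _).
  rewrite mulr_sumr -sumrN expR_sum rmorph_prod; apply: eq_bigr => k _.
  by rewrite mxE -fmorphV -expRN -rmorphXn /= -expRM_natl; congr (rc (expR _)); ring.
set x := t * _; set z := mcoeff a (f i).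
have -> : `|rc (expR x) * z| = rc (expR x * cmod z).
  by rewrite norm_cmod cmodM cmod_real ger0_norm ?expR_ge0.
rewrite -rmorphXn -(rmorph_nat rc) -(rmorph_nat rc (mdeg a)`!) -fmorphV -!rmorphM /=.
congr rc; rewrite (_ : _ * t = x *+ 2); last by rewrite /x; ring.
by rewrite mulr2n expRD; ring.
Qed.

Lemma bw_ln_geodesic_convex (H1 : 'M[R[i]]_m) (H2 : 'M[R[i]]_n) (f : 'I_m -> poly) :
  Defs.hermitian H1 -> Defs.hermitian H2 ->
  convex_R (fun t => ln (bw_norm (sys_act (expm (rc t *: H1), expm (rc t *: H2)) f))).
Proof.
move=> h1 h2.
have [U [d [uU E1]]] := hermitian_diagonalization h1.
have [V [e [uV E2]]] := hermitian_diagonalization h2.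
pose f1 := sys_act (mxstar U, mxstar V) f.
pose c (ia : 'I_m * multinom n) : R :=
  cmod (mcoeff ia.2 (f1 ia.1)) ^+ 2 * ((mfact ia.2)%:R / (mdeg ia.2)`!%:R).
pose l (ia : 'I_m * multinom n) := 2 * (d 0 ia.1 - \sum_k (ia.2 k)%:R * e 0 k).
(* Components and monomials are flattened into one index list, as [ln_exp_sum_convex] sums over a
   single index. The factor [1/2] below is the square root in the norm. *)
pose r := [seq (i, a) | i <- index_enum 'I_m, a <- msupp (f1 i)].
have c0 ia : 0 <= c ia by rewrite mulr_ge0 ?divr_ge0 ?ler0n // exprn_ge0 // cmod_ge0.
have := convex_RZ (_ : 0 <= 2^-1) (ln_exp_sum_convex r l c0).
rewrite invr_ge0 ler0n => /(_ isT); congr convex_R; apply/funext => t.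
rewrite -ln_sqrt; last by apply: sumr_ge0 => ia _; rewrite mulr_ge0 ?expR_ge0.
congr ln; rewrite {1}E1 {1}E2 !expm_hermitian // -!mulmxA.
have uD2 : diag_mx (\row_j rc (expR (t * e 0 j))) *m mxstar V \in unitmx.
  have := expm_hermitian_unit t h2; rewrite {1}E2 expm_hermitian // -mulmxA unitmx_mul.
  by case/andP.
(* The left factors [U] and [V] drop by unitary invariance; the right factors are absorbed into
   [f1]. *)
rewrite sys_actM ?(unitary_unit uV) // bw_norm_unitary // sys_actM; last first.
- exact: unitary_unit (unitary_star uV).
- by move: uD2; rewrite unitmx_mul => /andP[].
rewrite bw_norm_diag_exp -/f1 /r big_allpairs_dep /=.
by congr Num.sqrt.
Qed.
End BombieriWeylGeodesics.

Theorem theorem2p1 (R : realType) (m n : nat)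
    (G : set ('M[R[i]]_m * 'M[R[i]]_n))
    (N1 : 'M[R[i]]_(m, n) -> R) (N2 : 'M[R[i]]_(n, m) -> R) :
  (0 < m)%N -> (0 < n)%N ->
  symmetric_subgroup G ->
  unitarily_invariant_norm N1 -> unitarily_invariant_norm N2 ->
  (forall A : 'M[R[i]]_(m, n), A != 0 ->
     geodesically_convex G (C_mat N1 N2 A)) /\
  (forall (f : 'I_m -> mpoly.mpoly n R[i]) (xi : 'cV[R[i]]_n),
     (exists i, f i != 0) -> poly_jacobian f xi != 0 ->
     geodesically_convex G (C_sys N2 f xi)).
Proof.
move=> _ _ symG uN1 uN2; split=> [A _|f xi _ _]; split=> [k g Kk Gg|g H Gg HH].
(* In [X A Y^-1] the element [k] contributes [k.1] on the left and the star of [k.2] on the right,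
   both unitary. *)
- have [_ [k1 k2]] := Kk; have [_ g2] := G_unit symG Gg.
  apply: ln_add_congr; last exact: (pinv_term_invariant symG (Defs.pinv A) uN2 Kk Gg).
  case: uN1 => _ _ _ inv; rewrite /=.
  rewrite (mul_invmx (unitary_unit k2) g2) (invmx_of_unitary k2).
  rewrite -[RHS](inv k.1 (mxstar k.2)) //; first by rewrite !mulmxA.
  exact: unitary_star.
(* The geodesic through [g] acting on [A] is the geodesic through the identity acting on
   [X A Y^-1]. *)
- have [_ [h1 h2]] := HH; have [_ g2] := G_unit symG Gg.
  apply: convex_RD; last exact: (pinv_term_convex symG (Defs.pinv A) uN2 Gg HH).
  have := uin_ln_geodesic_convex (g.1 *m A *m invmx g.2) uN1 h1 h2.
  congr convex_R; apply/funext => t; congr (ln (N1 _)).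
  by rewrite (mul_invmx (expm_hermitian_unit t h2) g2) !mulmxA.
- have [_ [k1 k2]] := Kk; have [_ g2] := G_unit symG Gg.
  apply: ln_add_congr; last first.
    exact: (pinv_term_invariant symG (Defs.pinv (poly_jacobian f xi)) uN2 Kk Gg).
  case: g Gg g2 => X Y Gg g2; apply: etrans (bw_norm_unitary _ k1 k2).
  exact: (congr1 (@bw_norm _ _ _) (sys_actM k.1 X f (unitary_unit k2) g2)).
- have [_ [h1 h2]] := HH; have [_ g2] := G_unit symG Gg.
  apply: (@convex_RD _ (fun t => ln (bw_norm (sys_act _ f)))); last first.
    exact: (pinv_term_convex symG (Defs.pinv (poly_jacobian f xi)) uN2 Gg HH).
  case: g Gg g2 => X Y Gg g2.
  (* Likewise, by the action property, the base point [(X, Y)] is moved into the system. *)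
  apply: (eq_convex_R _ (bw_ln_geodesic_convex (sys_act (X, Y) f) h1 h2)) => t.
  exact: (esym (congr1 (fun p => ln (bw_norm p))
    (sys_actM _ X f (expm_hermitian_unit t h2) g2))).
Qed.
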